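(* Let $\{(x^k,y^k)\}$ be an infinite sequence generated by the Inexact Penalty Decomposition Method (defined in the context) with $\delta_k\to 0$ and $\tau_k\to\infty$, and let $(\bar x,\bar y)$ be an accumulation point of this sequence that is feasible for the problem $$\min_{x,y} f(x)\quad\text{s.t.}\quad x-y=0,\ G(x)\in C,\ y\in D. \qquad (\mathrm{Q})$$ Then $(\bar x,\bar y)$ is an AM-stationary point of the optimization problem $(\mathrm{Q})$.
   Context: Setting: $\mathbb X,\mathbb Y$ are Euclidean spaces (real finite-dimensional Hilbert spaces), $f:\mathbb X\to\mathbb R$ and $G:\mathbb X\to\mathbb Y$ are continuously differentiable, $C\subseteq\mathbb Y$ is nonempty, closed and convex, and $D\subseteq\mathbb X$ is nonempty and closed (not necessarily convex). Product spaces carry the product inner product. Notation: $\mathrm{dist}_C(y)=\min_{z\in C}\|z-y\|$. For a nonempty closed set $S$ in a Euclidean space $\mathbb E$, $\Pi_S(x)=\operatorname{argmin}_{z\in S}\|z-x\|$ is the (set-valued) projection. The limiting normal cone of $S$ at $\bar x\in S$ is $$\mathcal N_S^{\lim}(\bar x)=\big\{w\in\mathbb E : \exists v^k\to\bar x,\ \exists w^k\to w \text{ with } w^k\in\mathrm{cone}\big(v^k-\Pi_S(v^k)\big)\ \forall k\in\mathbb N\big\},$$ where $\mathrm{cone}(A)=\{ta: t\ge 0,\ a\in A\}$. For convex $S$ and $\bar x\in S$, $\mathcal N_S(\bar x)=\{\lambda:\langle\lambda,x-\bar x\rangle\le 0\ \forall x\in S\}$. Both cones are defined to be $\emptyset$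 if $\bar x\notin S$. $G'(x)^*$ is the adjoint of the derivative $G'(x)$. Penalty function: for $\tau>0$, $q_\tau(x,y)=f(x)+\frac{\tau}{2}\big(\|x-y\|^2+\mathrm{dist}_C^2(G(x))\big)$ for $(x,y)\in\mathbb X\times\mathbb X$; $\nabla_x q_\tau$ is its gradient with respect to $x$. Inexact Penalty Decomposition Method: choose $\delta_0\ge 0$, $\tau_0>0$ and a starting point $(x^0,y^0)\in\mathbb X\times\mathbb X$. For $k=0,1,2,\dots$ compute $(x^{k+1},y^{k+1})$ such that $$\|\nabla_x q_{\tau_k}(x^{k+1},y^{k+1})\|\le\delta_k\quad\text{and}\quad y^{k+1}\in\operatorname{argmin}_{y\in D} q_{\tau_k}(x^{k+1},y),$$ and then choose $\delta_{k+1}\le\delta_k$ (with $\delta_{k+1}\ge0$) and $\tau_{k+1}>\tau_k$. AM-stationarity (general): for a problem $\min_w\varphi(w)$ s.t. $H(w)\in K$, $w\in S$, with $\varphi,H$ continuously differentiable maps between Euclidean spaces, $K$ nonempty closed convex, $S$ nonempty closed, a feasible point $\bar w$ is AM-stationary (asymptotically M-stationary) if there exist sequences $w^k\to\bar w$, $\varepsilon^k\to 0$, $z^k\to 0$ and $\{\lambda^k\}$ such that for all $k\in\mathbb N$ $$\varepsilon^k\in\nabla\varphi(w^k)+H'(w^k)^*\lambda^k+\mathcal N_S^{\lim}(w^k),\qquad \lambda^k\in\mathcal N_K\big(H(w^k)-z^k\big).$$ Problem $(\mathrm Q)$ is regarded as such a problem with $w=(x,y)\in\mathbb X\times\mathbb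 X$, $\varphi(x,y)=f(x)$, $H(x,y)=(G(x),x-y)$, $K=C\times\{0\}$, $S=\mathbb X\times D$. *)

(* Defs.v *)
From HB Require Import structures.
From mathcomp Require Import all_boot all_order all_algebra.
From mathcomp Require Import all_classical all_reals all_analysis.
From mathcomp Require Import ring lra.

Set Implicit Arguments.
Unset Strict Implicit.
Unset Printing Implicit Defensive.

Import Order.TTheory GRing.Theory Num.Theory.
Import numFieldNormedType.Exports.

Local Open Scope classical_set_scope.
Local Open Scope ring_scope.

(* A real finite-dimensional Hilbert space: [Vector] gives the finite dimension
   (hence completeness), and the norm and topology are those of [inner]. *)
HB.mixin Record NormedVector_isEuclidean (R : realType) E
    & NormedModule R E & Vector R E := {
  inner : E -> E -> R;
  innerC : forall u v, inner u v = inner v u;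
  innerDl : forall u v w, inner (u + v) w = inner u w + inner v w;
  innerZl : forall (a : R) u v, inner (a *: u) v = a * inner u v;
  inner_norm : forall u, inner u u = `|u| ^+ 2
}.

#[short(type="euclideanType")]
HB.structure Definition Euclidean (R : realType) :=
  {E of NormedModule R E & Vector R E & NormedVector_isEuclidean R E}.

HB.factory Record Vector_isEuclidean (R : realType) E & Vector R E := {
  inner : E -> E -> R;
  innerC : forall u v, inner u v = inner v u;
  innerDl : forall u v w, inner (u + v) w = inner u w + inner v w;
  innerZl : forall (a : R) u v, inner (a *: u) v = a * inner u v;
  inner_gt0 : forall u, u != 0 -> 0 < inner u u
}.

HB.builders Context R E & Vector_isEuclidean R E.

Let inner0l v : inner 0 v = 0.
Proof. by rewrite -(scale0r (0 : E)) innerZl mul0r. Qed.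

Let inner_ge0 u : 0 <= inner u u.
Proof.
by have [->|/inner_gt0/ltW//] := eqVneq u 0; rewrite inner0l.
Qed.

Let enorm u := Num.sqrt (inner u u).

Let innerDD u v :
  inner (u + v) (u + v) = inner u u + 2 * inner u v + inner v v.
Proof.
rewrite innerDl innerC [inner v _]innerC !innerDl (innerC v u); ring.
Qed.

Let cauchy_schwarz u v : inner u v ^+ 2 <= inner u u * inner v v.
Proof.
have [->|v0] := eqVneq v 0; first by rewrite (innerC u) !inner0l mulr0 expr0n.
have vv := inner_gt0 v0.
have := inner_ge0 (inner v v *: u + (- inner u v) *: v).
rewrite innerDD !innerZl [inner u (_ *: _)]innerC [inner v (_ *: _)]innerC.
rewrite [inner u (_ *: v)]innerC !innerZl (innerC v u) => h.
suff : 0 <= inner v v * (inner u u * inner v v - inner u v ^+ 2).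
  by rewrite pmulr_rge0// subr_ge0.
by apply: le_trans h _; rewrite le_eqVlt; apply/orP; left; apply/eqP; ring.
Qed.

Let enormD u v : enorm (u + v) <= enorm u + enorm v.
Proof.
have uv0 : 0 <= enorm u + enorm v by rewrite addr_ge0// sqrtr_ge0.
rewrite -(ler_pXn2r (ltn0Sn 1)) ?nnegrE ?sqrtr_ge0//.
rewrite sqr_sqrtr// innerDD sqrrD !sqr_sqrtr// lerD2r lerD2l -[leRHS]mulr_natl.
rewrite ler_pM2l// -sqrtrM// (le_trans (ler_norm _))// -sqrtr_sqr.
by rewrite ler_wsqrtr// cauchy_schwarz.
Qed.

Let enormZ (a : R) u : enorm (a *: u) = `|a| * enorm u.
Proof.
rewrite /enorm innerZl innerC innerZl mulrA -expr2 sqrtrM ?sqr_ge0//.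
by rewrite sqrtr_sqr.
Qed.

Let enorm0_eq0 u : enorm u = 0 -> u = 0.
Proof.
move=> /eqP; rewrite sqrtr_eq0 => u0; apply/eqP; apply: contraT => /inner_gt0.
by rewrite ltNge u0.
Qed.

HB.instance Definition _ := Lmodule_isNormed.Build R E enormD enormZ enorm0_eq0.

Let inner_norm u : inner u u = `|u| ^+ 2.
Proof. by rewrite [`|u|]/(enorm u) sqr_sqrtr. Qed.

HB.instance Definition _ :=
  NormedVector_isEuclidean.Build R E innerC innerDl innerZl inner_norm.

HB.end.

(* The library puts the maximum norm on [E * F]; this alias carries the norm
   of the product inner product instead. *)
Definition eprod (E F : Type) : Type := (E * F)%type.

Section eprod.
Context {R : realType} {E F : euclideanType R}.

Let dot (u v : eprod E F) : R := inner u.1 v.1 + inner u.2 v.2.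

HB.instance Definition _ := Vector.copy (eprod E F) (E * F)%type.

Let dotC u v : dot u v = dot v u.
Proof. by rewrite /dot innerC (innerC u.2). Qed.

Let dotDl u v w : dot (u + v) w = dot u w + dot v w.
Proof. by rewrite /dot !innerDl addrACA. Qed.

Let dotZl (a : R) u v : dot (a *: u) v = a * dot u v.
Proof. by rewrite /dot !innerZl mulrDr. Qed.

Let dot_gt0 u : u != 0 -> 0 < dot u u.
Proof.
move=> u0; rewrite /dot !inner_norm lt_neqAle addr_ge0// ?exprn_ge0// andbT.
apply: contra u0; rewrite eq_sym paddr_eq0 ?exprn_ge0// !sqrf_eq0 !normr_eq0.
by case: u => a b /= /andP[/eqP-> /eqP->].
Qed.

HB.instance Definition _ :=
  Vector_isEuclidean.Build R (eprod E F) dotC dotDl dotZl dot_gt0.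

End eprod.

Section first_order.
Context {R : realType}.

(* The representative of a linear form, see [inner_riesz]; it is [0] when [l]
   has no representative. *)
Definition riesz {E : euclideanType R} (l : E -> R) : E :=
  xget 0 [set u | forall v, inner u v = l v].

Definition gradient {E : euclideanType R} (f : E -> R) (x : E) : E :=
  riesz ('d f x).

Definition adjoint {E F : euclideanType R} (L : E -> F) (y : F) : E :=
  riesz (fun v => inner (L v) y).

(* Continuity of the derivative is meant in the operator norm. *)
Definition continuously_differentiable {E F : normedModType R} (f : E -> F) :=
  (forall x, differentiable f x) /\
  (forall x (e : R), 0 < e ->
    \forall z \near x, forall v, `|'d f z v - 'd f x v| <= e * `|v|).

End first_order.

Section variational.
Context {R : realType} {E : euclideanType R}.
Implicit Types (S : set E) (x : E).

Definition argmin S (g : E -> R) : set E :=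
  [set a | S a /\ forall b, S b -> g a <= g b].

Definition proj S x : set E := argmin S (fun z => `|z - x|).

(* When [S] is nonempty and closed the infimum is a minimum. *)
Definition dist S x : R := inf [set `|z - x| | z in S].

Definition cone S : set E :=
  [set w | exists (t : R) u, [/\ 0 <= t, S u & w = t *: u]].

Definition limiting_normal_cone S x : set E :=
  [set w | S x /\ exists v w_ : nat -> E,
    [/\ v @ \oo --> x, w_ @ \oo --> w &
        forall k, cone [set v k - p | p in proj S (v k)] (w_ k)]].

Definition normal_cone S x : set E :=
  [set l | S x /\ forall z, S z -> inner l (z - x) <= 0].

End variational.

Section stationarity.
Context {R : realType} {W Z : euclideanType R}.

Definition feasible (H : W -> Z) (K : set Z) (S : set W) (w : W) :=
  K (H w) /\ S w.

Definition AM_stationary (phi : W -> R) (H : W -> Z) (K : set Z) (S : set W)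
    (w : W) :=
  feasible H K S w /\
  exists (w_ eps : nat -> W) (z lam : nat -> Z),
    [/\ w_ @ \oo --> w, eps @ \oo --> 0, z @ \oo --> 0 &
      forall k,
        (exists2 nu, limiting_normal_cone S (w_ k) nu &
           eps k = gradient phi (w_ k) + adjoint ('d H (w_ k)) (lam k) + nu) /\
        normal_cone K (H (w_ k) - z k) (lam k)].

End stationarity.

Section penalty_decomposition.
Context {R : realType} {X Y : euclideanType R}.
Variables (f : X -> R) (G : X -> Y) (C : set Y) (D : set X).

Definition penalty (tau : R) (x y : X) : R :=
  f x + tau / 2 * (`|x - y| ^+ 2 + dist C (G x) ^+ 2).

Definition inexact_penalty_decomposition (delta tau : nat -> R)
    (x y : nat -> X) :=
  [/\ forall k, 0 <= delta k, forall k, delta k.+1 <= delta k,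
      0 < tau 0%N, forall k, tau k < tau k.+1 &
      forall k,
        `|gradient (fun u => penalty (tau k) u (y k.+1)) (x k.+1)| <= delta k /\
        argmin D (penalty (tau k) (x k.+1)) (y k.+1)].

End penalty_decomposition.

Section riesz_theory.
Context {R : realType} {E : euclideanType R}.
Implicit Types u v w : E.

Lemma innerDr u v w : inner u (v + w) = inner u v + inner u w.
Proof. by rewrite innerC innerDl !(innerC u). Qed.

Lemma innerZr (a : R) u v : inner u (a *: v) = a * inner u v.
Proof. by rewrite innerC innerZl innerC. Qed.

Lemma inner_sumr u (I : Type) (r : seq I) (F : I -> E) :
  inner u (\sum_(i <- r) F i) = \sum_(i <- r) inner u (F i).
Proof.
by elim/big_ind2 : _ => [|? ? ? ? <- <-|//];
  rewrite ?innerDr// -(scale0r (0 : E)) innerZr mul0r.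
Qed.

Lemma inner_eq0 u : (inner u u == 0) = (u == 0).
Proof. by rewrite inner_norm sqrf_eq0 normr_eq0. Qed.

Lemma inner_riesz (l : {scalar E}) v : inner (riesz l) v = l v.
Proof.
have [u ul] : exists u, forall v, inner u v = l v; last first.
  by apply: (xgetPex 0 (P := [set u | forall v, inner u v = l v])); exists u.
pose b := vbasis (fullv : {vspace E}).
have bf : free b by exact: basis_free (vbasisP _).
pose g u := \sum_(i < \dim {:E}) inner u b`_i *: b`_i.
have gl : linear g.
  move=> a u w; rewrite /g scaler_sumr -big_split/=; apply: eq_bigr => i _.
  by rewrite innerDl innerZl scalerDl scalerA.
pose gL := GRing.isLinear.Build R E E _ g gl.
pose gH : {linear E -> E} := HB.pack g gL.
have gE u : linfun gH u = g u by rewrite lfunE.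
have bE u : u = \sum_(i < \dim {:E}) coord b i u *: b`_i by apply: coord_vbasis; rewrite memvf.
have ker0 : lker (linfun gH) == 0%VS.
  apply/lker0P => u w; rewrite !gE => uw; apply/eqP.
  rewrite -subr_eq0 -inner_eq0 [X in inner _ X]bE inner_sumr big1// => i _.
  rewrite innerZr -scaleN1r addrC innerDl innerZl.
  have /(congr1 (coord b i)) := uw; rewrite /g !coord_sum_free// => ->.
  by rewrite mulN1r addNr mulr0.
pose t := \sum_(i < \dim {:E}) l b`_i *: b`_i.
have : t \in limg (linfun gH) by rewrite (lker0_limgf ker0) memvf.
move=> /memv_imgP[u _]; rewrite gE => lu; exists u => w.
rewrite (bE w) inner_sumr linear_sum; apply: eq_bigr => i _.
rewrite innerZr linearZ/=; congr (_ * _).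
by have /(congr1 (coord b i)) := lu; rewrite /t /g !coord_sum_free.
Qed.

Lemma inner_gradient (f : E -> R) x v : inner (gradient f x) v = 'd f x v.
Proof. exact: inner_riesz. Qed.

Lemma inner_adjoint (F : euclideanType R) (L : {linear E -> F}) v (y : F) :
  inner v (adjoint L y) = inner (L v) y.
Proof.
have lP : scalar (fun v => inner (L v) y).
  by move=> a u w; rewrite linearP innerDl innerZl.
pose l : {scalar E} := HB.pack (fun v => inner (L v) y)
  (GRing.isLinear.Build R E R _ (fun v => inner (L v) y) lP).
by rewrite innerC; exact: (inner_riesz l).
Qed.

End riesz_theory.

(* Main.v *)
Require Import Defs.
From HB Require Import structures.
From mathcomp Require Import all_boot all_order all_algebra.
From mathcomp Require Import all_classical all_reals all_analysis.
From mathcomp Require Import ring lra.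
Import Order.TTheory GRing.Theory Num.Theory.
Import numFieldNormedType.Exports.
(* [proj] below is the metric projection onto a set. *)
Import Defs.
Local Open Scope classical_set_scope.
Local Open Scope ring_scope.

(** The iterates themselves are the approximate stationary points.  Write
    [P] for the projection onto the closed convex set [C].  The function
    [dist C ^+ 2] is differentiable with gradient [2 (u - P u)]
    ([is_diff_sqdist]), so the gradient of the penalty function in its first
    argument is
<<
      grad f(x) + tau (x - y) + G'(x)^* (tau (G x - P (G x)))
>>
    ([inner_gradient_penalty]).  This is the first component of the Lagrangian
    inclusion for (Q) at [w = (x, y)] with the multiplier
<<
      lam = (tau (G x - P (G x)), tau (x - y)) = tau z.
>>
    The shift [z = (G x - P (G x), x - y)] moves the constraint value
    [H w = (G x, x - y)] to the point [(P (G x), 0)] of [C * {0}], and [lam] is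
    normal to [C * {0}] there, because [G x - P (G x)] is normal to [C] at
    [P (G x)] ([proj_normal]).

    The second component of the inclusion reads [0 = - tau (x - y) + nu], so
    one needs [tau (x - y)] to be a limiting normal of [D] at [y].  The exact
    minimisation in [y] says precisely that [y] is a projection of [x] onto
    [D]; then [y] is also a projection of every point of the segment from [y]
    to [x] ([proj_segment]), and letting such points tend to [y] shows that
    [x - y] is a limiting normal ([proj_limiting_normal]).

    Along a subsequence converging to the feasible accumulation point, the
    residual [eps = (grad_x q_tau, 0)] is bounded by [delta] and tends to
    [0], while [z] tends to [0] because [x - y] does and because, [G xbar]
    lying in [C], [|G x - P (G x)| <= |G x - G xbar|]. *)

Set Implicit Arguments.
Unset Strict Implicit.

(** * Inner products and finite dimension *)

Lemma inner0r {R : realType} {E : euclideanType R} (u : E) : inner u 0 = 0.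
Proof. by rewrite -(scale0r (0 : E)) innerZr mul0r. Qed.

Lemma innerNr {R : realType} {E : euclideanType R} (u v : E) :
  inner u (- v) = - inner u v.
Proof. by rewrite -scaleN1r innerZr mulN1r. Qed.

Lemma normD_sqr {R : realType} {E : euclideanType R} (u v : E) :
  `|u + v| ^+ 2 = `|u| ^+ 2 + 2 * inner u v + `|v| ^+ 2.
Proof.
rewrite -!inner_norm innerDl !innerDr (innerC v u); ring.
Qed.

Lemma inner_eqP {R : realType} {E : euclideanType R} (u v : E) :
  (forall h, inner u h = inner v h) -> u = v.
Proof.
move=> uv; apply/eqP; rewrite -subr_eq0 -inner_eq0.
by rewrite innerDl uv -innerDl subrr innerC inner0r.
Qed.

Lemma inner_le_norm {R : realType} {E : euclideanType R} (u v : E) :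
  `|inner u v| <= `|u| * `|v|.
Proof.
have key (w z : E) : inner w z <= `|w| * `|z|.
  have : `|w + z| ^+ 2 <= (`|w| + `|z|) ^+ 2.
    by rewrite ler_sqr ?nnegrE// ?ler_normD// addr_ge0.
  rewrite normD_sqr sqrrD; lra.
rewrite ler_norml key andbT.
by have := key u (- v); rewrite innerNr normrN lerNl.
Qed.

(** By the Riesz representation of the coordinate forms; this replaces the
    equivalence of norms in finite dimension. *)
Lemma coord_bounded {R : realType} {E : euclideanType R} n (b : n.-tuple E) i :
  exists2 M : R, 0 <= M & forall v, `|coord b i v| <= M * `|v|.
Proof.
exists `|riesz (coord b i)| => // v.
have <- : inner (riesz (coord b i)) v = coord b i v := inner_riesz (coord b i) v.
exact: inner_le_norm.
Qed.

Lemma euclidean_linear_continuous {R : realType} {E : euclideanType R}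
  {V : normedModType R} (L : {linear E -> V}) : continuous L.
Proof.
pose b := vbasis (fullv : {vspace E}).
have /cid[M LM] : exists M : R, forall v, `|L v| <= M * `|v|.
  have c i := cid2 (coord_bounded b i).
  exists (\sum_i sval (c i) * `|L b`_i|) => v.
  rewrite {1}(coord_vbasis (memvf v)) linear_sum/= (le_trans (ler_norm_sum _ _ _))//.
  rewrite mulr_suml; apply: ler_sum => i _.
  rewrite linearZ/= normrZ mulrAC ler_wpM2r//.
  by case: (c i).
apply: bounded_linear_continuous; apply/linear_boundedP.
near=> r => v; apply: (le_trans (LM v)); apply: ler_wpM2r; first exact: normr_ge0.
by near: r; apply: nbhs_pinfty_ge; exact: num_real.
Unshelve. all: by end_near. Qed.

Lemma is_diff_linear {R : realType} {E : euclideanType R}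
  {V : normedModType R} (L : {linear E -> V}) x : is_diff x L L.
Proof.
apply: DiffDef; first exact/linear_differentiable/euclidean_linear_continuous.
exact/diff_lin/euclidean_linear_continuous.
Qed.

(** The coordinates of a bounded set lie in a box, which is compact, and the
    set is the continuous image of a closed part of that box. *)
Lemma euclidean_bounded_closed_compact {R : realType} {E : euclideanType R}
  (A : set E) (M : R) : (forall u, A u -> `|u| <= M) -> closed A -> compact A.
Proof.
move=> AM Acl.
pose b := vbasis (fullv : {vspace E}).
pose phi (c : 'rV[R]_(\dim {:E})) : E := \sum_i c ord0 i *: b`_i.
have phic : continuous phi.
  apply: continuous_big => [|i _ w]; first exact: add_continuous.
  apply: (@cvgZr_tmp _ _ _ (nbhs w)); exact: coord_continuous.
have c i := cid2 (coord_bounded b i).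
have bf : free b by exact: basis_free (vbasisP _).
pose I i := `[- (sval (c i) * M), sval (c i) * M]%classic : set R.
have Ico : compact [set v : 'rV[R]_(\dim {:E}) | forall i, I i (v ord0 i)].
  by apply: (@rV_compact _ _ I) => i; apply: segment_compact.
have -> : A = phi @` (phi @^-1` A).
  apply/seteqP; split => [u Au|u [w Aw <-//]].
  suff e : phi (\row_i coord b i u) = u by exists (\row_i coord b i u) => //=; rewrite e.
  by rewrite [RHS](coord_vbasis (memvf u)); apply: eq_bigr => i _; rewrite mxE.
apply: continuous_compact; first exact: continuous_subspaceT.
apply: subclosed_compact Ico _; first by apply: closed_comp Acl => ? _; exact: phic.
move=> w Aw i; rewrite /I/= in_itv/= -ler_norml.
have -> : w ord0 i = coord b i (phi w) by rewrite /phi coord_sum_free.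
case: (c i) => K /= K0 /(_ (phi w)) h; rewrite (le_trans h)// ler_wpM2l//.
exact: AM.
Qed.

(** * Projections and the squared distance to a convex set *)

Lemma proj_nonempty {R : realType} {E : euclideanType R} (S : set E) (x : E) :
  S !=set0 -> closed S -> proj S x !=set0.
Proof.
move=> [s Ss] Scl.
pose A := S `&` [set z | `|z - x| <= `|s - x|].
have distc : continuous (fun z : E => `|z - x|).
  by move=> z; apply: cvg_norm; apply: cvgB; [exact: cvg_id|exact: cvg_cst].
have Aco : compact A.
  apply: (@euclidean_bounded_closed_compact _ _ A (`|s - x| + `|x|)).
    move=> u [_ /= us]; rewrite -[u in `|u|](subrK x) (le_trans (ler_normD _ _))//.
    by rewrite lerD2r.
  apply: closedI => //.
  apply: (@closed_comp _ _ (fun z : E => `|z - x|) [set r | r <= `|s - x|]).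
    by move=> z _; exact: distc.
  exact: closed_le.
have A0 : A !=set0 by exists s; split => //=.
have [p] := compact_EVT_min A0 Aco (continuous_subspaceT distc).
rewrite inE => -[Sp /= ps] pmin; exists p; split => // z Sz.
have [zs|/ltW sz] := leP `|z - x| `|s - x|; last exact: le_trans ps sz.
by apply: pmin; rewrite inE; split.
Qed.

Lemma dist_proj {R : realType} {E : euclideanType R} (S : set E) (x p : E) :
  proj S x p -> dist S x = `|p - x|.
Proof.
move=> [Sp pmin]; apply/eqP; rewrite eq_le; apply/andP; split.
  apply: ge_inf; last by exists p.
  by exists 0 => _ [z _ <-].
apply: lb_le_inf; first by exists `|p - x|, p.
by move=> _ [z Sz <-]; exact: pmin.
Qed.

(** If [a = inner (x - p) (z - p)] were positive, then the points
    [p + t (z - p)] of [C] would be closer to [x] than [p] for small [t]. *)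
Lemma proj_normal {R : realType} {E : euclideanType R} (C : set E) (x p : E) :
  convex_set (C : set (convex_lmodType E)) -> proj C x p ->
  normal_cone C p (x - p).
Proof.
move=> Ccvx [Cp pmin]; split => // z Cz; rewrite leNgt; apply/negP => a0.
set a := inner _ _ in a0; set N := `|z - p| ^+ 2.
have N0 : 0 <= N by rewrite exprn_ge0.
have N1 : 0 < N + a by lra.
(* Small enough for both [t <= 1] and [t * N < 2 * a]. *)
pose t := a / (N + a).
have t0 : 0 < t by rewrite divr_gt0.
have t1 : t <= 1 by rewrite ler_pdivrMr// mul1r; lra.
have Ct : C (p + t *: (z - p)).
  pose l := @Itv01 R t (ltW t0) t1.
  have := Ccvx z p l; rewrite !inE => /(_ Cz Cp).
  rewrite /conv/= /unstable.onem.
  suff -> : t *: z + (1 - t) *: p = p + t *: (z - p) by [].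
  by rewrite scalerBl scale1r scalerBr addrCA.
have := pmin _ Ct; rewrite -ler_sqr ?nnegrE// addrAC.
rewrite -(opprB x p) (normD_sqr (- _)) (innerC (- _)) innerNr (innerC (_ *: _)).
rewrite innerZr !normrN normrZ mulrN exprMn real_normK ?num_real// -/a -/N => h.
have : 2 * a <= t * N.
  by rewrite -(ler_pM2l t0); nra.
rewrite /t mulrAC ler_pdivlMr//; nra.
Qed.

(** The remainder of the first-order expansion lies between [0] and [|h|^2].
    The upper bound compares the distance of [x + h] with [|x + h - p|]; the
    lower bound drops the square of [h - (q - p)], where [q] is a projection of
    [x + h], and uses that [x - p] is normal to [C] at [p]. *)
Lemma is_diff_sqdist {R : realType} {E : euclideanType R} (C : set E) (x p : E) :
  C !=set0 -> closed C -> convex_set (C : set (convex_lmodType E)) ->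
  proj C x p ->
  is_diff x (fun u => dist C u ^+ 2) (fun h => 2 * inner (x - p) h).
Proof.
move=> C0 Ccl Ccvx xp.
have dfP : scalar (fun h => 2 * inner (x - p) h : R).
  by move=> a u v; rewrite innerDr innerZr /=; ring.
pose df : {scalar E} := HB.pack (fun h => 2 * inner (x - p) h : R)
  (GRing.isLinear.Build R E R _ _ dfP).
have dfc : continuous (df : E -> R) := @euclidean_linear_continuous _ _ _ df.
have rem h : 0 <= dist C (h + x) ^+ 2 - dist C x ^+ 2 - 2 * inner (x - p) h
    <= `|h| ^+ 2.
  have [q hq] := proj_nonempty (h + x) C0 Ccl.
  have [Cp _] := xp; have [Cq qmin] := hq.
  rewrite (dist_proj xp) (dist_proj hq); apply/andP; split.
    have [_ /(_ q Cq) pq] := proj_normal Ccvx xp.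
    rewrite !(distrC _ x) (distrC q) (_ : h + x - q = (x - p) + (h - (q - p))); last first.
      by rewrite opprB addrCA subrKA addrA.
    rewrite normD_sqr innerDr innerNr; have := exprn_ge0 2 (normr_ge0 (h - (q - p))); lra.
  have := qmin _ Cp; rewrite -ler_sqr ?nnegrE// ; rewrite !(distrC p).
  by rewrite -addrA (addrC h (x - p)) (normD_sqr (x - p)); lra.
have o : (fun u => dist C u ^+ 2) \o shift x =
    cst (dist C x ^+ 2) + (df : E -> R) +o_ 0 id.
  apply/eqaddoP => _/posnumP[e]; near=> h.
  have /andP[r0 r1] := rem h.
  rewrite /= !fctE/= opprD addrA ger0_norm//.
  apply: (le_trans r1); rewrite expr2; apply: ler_wpM2r; first exact: normr_ge0.
  by near: h; exact: nbhs0_le.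
have dE : 'd (fun u => dist C u ^+ 2) x = df :> (E -> R) by exact: diff_unique.
apply: DiffDef => //.
by apply/diff_locallyP; rewrite dE.
Unshelve. all: by end_near. Qed.

Lemma dist_set1 {R : realType} {E : euclideanType R} (y x : E) :
  dist [set y] x = `|x - y|.
Proof. by rewrite distrC; apply: dist_proj; split => // z ->. Qed.

Lemma gradient_is_diff {R : realType} {E : euclideanType R} (f : E -> R)
  (df : E -> R) x h : is_diff x f df -> inner (gradient f x) h = df h.
Proof. by move=> fx; rewrite inner_gradient diff_val. Qed.

(** Both quadratic terms of the penalty are squared distances to convex sets:
    [|x - y|] is the distance of [x] to the singleton [{y}]. *)
Lemma inner_gradient_penalty {R : realType} {X Y : euclideanType R}
  (f : X -> R) (G : X -> Y) (C : set Y) (tau : R) (x y : X) (p : Y) (h : X) :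
  differentiable f x -> differentiable G x ->
  C !=set0 -> closed C -> convex_set (C : set (convex_lmodType Y)) ->
  proj C (G x) p ->
  inner (gradient (fun u => penalty f G C tau u y) x) h =
  'd f x h + inner (tau *: (x - y)) h + inner (tau *: (G x - p)) ('d G x h).
Proof.
move=> /differentiableP fx /differentiableP Gx C0 Ccl Ccvx xp.
have y0 : [set y] !=set0 by exists y.
have ycl : closed [set y].
  exact/accessible_closed_set1/hausdorff_accessible/norm_hausdorff.
have ycvx : convex_set ([set y] : set (convex_lmodType X)).
  by move=> a b l; rewrite !inE => -> ->; rewrite convmm.
have yp : proj [set y] x y by split => // z ->.
have dy := is_diff_sqdist y0 ycl ycvx yp.
have dC := is_diff_sqdist C0 Ccl Ccvx xp.
have dCG := is_diff_comp Gx dC.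
have -> : (fun u => penalty f G C tau u y) =
    f + (tau / 2) *: ((fun u => dist [set y] u ^+ 2) +
                      ((fun z => dist C z ^+ 2) \o G)).
  by apply/funext => u; rewrite /penalty !fctE /= dist_set1.
rewrite (gradient_is_diff h (is_diffD fx (is_diffZ (tau / 2) (is_diffD dy dCG)))).
rewrite !fctE /= !innerZl -addrA; congr (_ + _).
by rewrite /GRing.scale/=; field.
Qed.

(** * Convergence and derivatives in product spaces *)

Section eprod_theory.
Context {R : realType} {E F : euclideanType R}.
Implicit Types u v : eprod E F.

Lemma inner_eprod u v : inner u v = inner u.1 v.1 + inner u.2 v.2.
Proof. by []. Qed.

Lemma norm_eprod_sqr u : `|u| ^+ 2 = `|u.1| ^+ 2 + `|u.2| ^+ 2.
Proof. by rewrite -!inner_norm. Qed.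

Lemma efst_linear : linear (fun u => u.1).
Proof. by []. Qed.

Lemma esnd_linear : linear (fun u => u.2).
Proof. by []. Qed.

Lemma einl_linear : linear (fun a => (a, 0) : eprod E F).
Proof.
by move=> c a b; congr (_, _); rewrite /= scaler0 addr0.
Qed.

Lemma einr_linear : linear (fun a => (0, a) : eprod E F).
Proof.
by move=> c a b; congr (_, _); rewrite /= scaler0 addr0.
Qed.

Definition efst : {linear eprod E F -> E} :=
  HB.pack (fun u : eprod E F => u.1) (GRing.isLinear.Build _ _ _ _ _ efst_linear).
Definition esnd : {linear eprod E F -> F} :=
  HB.pack (fun u : eprod E F => u.2) (GRing.isLinear.Build _ _ _ _ _ esnd_linear).
Definition einl : {linear E -> eprod E F} :=
  HB.pack (fun a => (a, 0) : eprod E F) (GRing.isLinear.Build _ _ _ _ _ einl_linear).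
Definition einr : {linear F -> eprod E F} :=
  HB.pack (fun b => (0, b) : eprod E F) (GRing.isLinear.Build _ _ _ _ _ einr_linear).

(** Reduces limits and derivatives of pairs to linear maps, which are
    continuous in finite dimension. *)
Lemma eprodE (a : E) (b : F) : (a, b) = einl a + einr b :> eprod E F.
Proof. by rewrite /=; congr (_, _); rewrite /= ?addr0 ?add0r. Qed.

Lemma cvg_eprod T (G : set_system T) (f : T -> E) (g : T -> F) a b :
  Filter G -> f @ G --> a -> g @ G --> b ->
  (fun t => (f t, g t) : eprod E F) @ G --> ((a, b) : eprod E F).
Proof.
move=> FG fa gb; rewrite eprodE; under eq_cvg do rewrite eprodE.
by apply: cvgD; apply: continuous_cvg => //; exact: euclidean_linear_continuous.
Qed.

Lemma is_diff_eprod (V : normedModType R) (f df : V -> E) (g dg : V -> F) x :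
  is_diff x f df -> is_diff x g dg ->
  is_diff x (fun t => (f t, g t) : eprod E F) (fun h => (df h, dg h)).
Proof.
move=> fx gx.
have := is_diffD (is_diff_comp fx (is_diff_linear einl (f x)))
                 (is_diff_comp gx (is_diff_linear einr (g x))).
have -> : (einl \o f) + (einr \o g) = (fun t => (f t, g t) : eprod E F).
  by apply/funext => t; rewrite [RHS]eprodE.
have -> // : (einl \o df) + (einr \o dg) = (fun t => (df t, dg t) : eprod E F).
by apply/funext => t; rewrite [RHS]eprodE.
Qed.

End eprod_theory.

(** * Normal cones *)

(** Every point of [S] is at distance at least [|x - p|] from [x], and the
    intermediate point is [(1 - t) |x - p|] away from [x]. *)
Lemma proj_segment {R : realType} {E : euclideanType R} (S : set E) (x p : E)
  (t : R) : 0 <= t <= 1 -> proj S x p -> proj S (p + t *: (x - p)) p.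
Proof.
move=> /andP[t0 t1] [Sp pmin]; split => // z Sz.
rewrite (_ : p - (p + _) = - (t *: (x - p))); last by rewrite opprD addNKr.
rewrite normrN normrZ ger0_norm//.
have zx : z - (p + t *: (x - p)) + (t - 1) *: (x - p) = z - x.
  rewrite scalerBl scale1r opprD -!addrA; congr (_ + _).
  by rewrite addKr opprB addKr.
have := pmin _ Sz; have := ler_normD (z - (p + t *: (x - p))) ((t - 1) *: (x - p)).
rewrite zx normrZ ler0_norm ?subr_le0// (distrC p); lra.
Qed.

(** The vectors [x - p] themselves are not attached to base points near [p];
    moving the base point from [x] to [p] along the segment keeps both the
    projection and the direction. *)
Lemma proj_limiting_normal {R : realType} {E : euclideanType R} (S : set E)
  (x p : E) (c : R) : 0 <= c -> proj S x p ->
  limiting_normal_cone S p (c *: (x - p)).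
Proof.
move=> c0 xp; split; first by case: xp.
exists (fun k => p + (k.+1%:R)^-1 *: (x - p)), (fun=> c *: (x - p)); split.
- rewrite -[X in _ --> X]addr0 -(scale0r (x - p)).
  apply: cvgD; first exact: cvg_cst.
  by apply: cvgZr_tmp; exact: cvg_harmonic.
- exact: cvg_cst.
- move=> k; exists (c * k.+1%:R), (k.+1%:R^-1 *: (x - p)); split.
  + by rewrite mulr_ge0.
  + exists p; last by rewrite addrC addKr.
    by apply: proj_segment xp; rewrite invr_ge0 ler0n/= invf_le1// ler1n.
  + by rewrite scalerA mulfK.
Qed.

Lemma proj_setTX {R : realType} {E F : euclideanType R} (D : set F) (a : E)
  (x y : F) : proj D x y ->
  proj (setT `*` D : set (eprod E F)) (a, x) (a, y).
Proof.
move=> [Dy ymin]; split => // -[b z] [_ /= Dz].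
rewrite -ler_sqr ?nnegrE// !norm_eprod_sqr/= subrr normr0 expr0n add0r.
by rewrite ler_wpDl ?exprn_ge0// ler_sqr ?nnegrE// ymin.
Qed.

Lemma normal_cone_setX {R : realType} {E F : euclideanType R} (A : set E)
  (B : set F) a b l m : normal_cone A a l -> normal_cone B b m ->
  normal_cone (A `*` B : set (eprod E F)) (a, b) (l, m).
Proof.
move=> [Aa lP] [Bb mP]; split => // -[z w] [/= Az Bw].
have := lP _ Az; have := mP _ Bw; rewrite inner_eprod/=; lra.
Qed.

Lemma normal_cone_scale {R : realType} {E : euclideanType R} (S : set E) x l
  (c : R) : 0 <= c -> normal_cone S x l -> normal_cone S x (c *: l).
Proof.
move=> c0 [Sx lP]; split => // z Sz.
by rewrite innerZl; apply: mulr_ge0_le0 => //; exact: lP.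
Qed.

(** * The penalty decomposition method *)

Lemma cluster_subsequence {R : realType} {V : normedModType R} (u : nat -> V) l :
  cluster (u @ \oo) l ->
  exists s : nat -> nat, (forall n, (n < s n)%N) /\ (u \o s) @ \oo --> l.
Proof.
move=> ul.
have /choice[s sP] n : exists m, (n < m)%N /\ `|l - u m| < n.+1%:R^-1.
  have inf : (u @ \oo) (u @` [set m | (n < m)%N]).
    by exists n.+1 => // m /= nm; exists m.
  have [] := ul _ _ inf (nbhsx_ballx l (n.+1%:R^-1) _); first by rewrite invr_gt0.
  by move=> _ [[m nm <-]]; rewrite -ball_normE/= => lm; exists m.
exists s; split => [n|]; first by case: (sP n).
apply/cvgrPdist_le => e e0; near=> n.
have [_ /ltW h] := sP n; apply: (le_trans h); near: n.
have := @cvg_harmonic R => /cvgr0_norm_le/(_ _ e0); apply: filterS => n /=.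
by rewrite ger0_norm// invr_ge0.
Unshelve. all: by end_near. Qed.

Unset Implicit Arguments.
Set Strict Implicit.

Theorem theorem3p3 (R : realType) (X Y : euclideanType R)
    (f : X -> R) (G : X -> Y) (C : set Y) (D : set X)
    (f_C1 : continuously_differentiable f)
    (G_C1 : continuously_differentiable G)
    (C_nonempty : C !=set0) (C_closed : closed C)
    (C_convex : convex_set (C : set (convex_lmodType Y)))
    (D_nonempty : D !=set0) (D_closed : closed D)
    (delta tau : nat -> R) (x y : nat -> X)
    (xy_method : inexact_penalty_decomposition f G C D delta tau x y)
    (delta_cvg : delta @ \oo --> 0) (tau_cvg : tau @ \oo --> +oo)
    (xbar ybar : X)
    (xy_cluster :
      cluster ((fun k => (x k, y k) : eprod X X) @ \oo) (xbar, ybar))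
    (xy_feasible : [/\ xbar - ybar = 0, C (G xbar) & D ybar]) :
  AM_stationary
    (fun w : eprod X X => f w.1)
    (fun w : eprod X X => (G w.1, w.1 - w.2) : eprod Y X)
    (C `*` [set 0]) (setT `*` D) (xbar, ybar).
Proof.
have [df _] := f_C1; have [dG _] := G_C1.
have [_ _ tau0 tau_incr method] := xy_method.
have [xybar CGxbar Dybar] := xy_feasible.
have tau_gt0 k : 0 < tau k by elim: k => // k /lt_trans; apply.
have [s [s_gt s_cvg]] := cluster_subsequence xy_cluster.
(* The iterate [s n] comes from step [m n] of the method, with the parameters
   [delta (m n)] and [tau (m n)]. *)
pose m n := (s n).-1.
have mS n : (m n).+1 = s n by rewrite prednK// (leq_ltn_trans _ (s_gt n)).
have m_cvg : m @ \oo --> \oo.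
  apply/cvgnyPge => N; near=> n.
  rewrite -ltnS mS (leq_trans _ (s_gt n))// ltnS; near: n.
  exact: nbhs_infty_ge.
pose a n := x (s n); pose b n := y (s n).
have a_cvg : a @ \oo --> xbar.
  exact: cvg_comp s_cvg (@euclidean_linear_continuous _ _ _ efst (xbar, ybar)).
have b_cvg : b @ \oo --> ybar.
  exact: cvg_comp s_cvg (@euclidean_linear_continuous _ _ _ esnd (xbar, ybar)).
have /choice[P PG] : forall z, exists p, proj C z p.
  by move=> z; exact: proj_nonempty.
have b_proj n : proj D (a n) (b n).
  have [_ [Db bmin]] := method (m n); rewrite mS in Db bmin.
  split => // z Dz; have := bmin z Dz; rewrite /penalty lerD2l.
  rewrite ler_pM2l ?divr_gt0// lerD2r ler_sqr ?nnegrE//.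
  by rewrite (distrC (b n)) (distrC z).
pose g n := gradient (fun u => penalty f G C (tau (m n)) u (b n)) (a n).
have g_cvg : g @ \oo --> 0.
  apply/norm_cvg0P; apply: (@squeeze_cvgr _ _ _ _ (cst 0) (delta \o m)).
  - near=> n; rewrite normr_ge0/= /g /a /b -mS.
    by have [] := method (m n).
  - exact: cvg_cst.
  - exact: cvg_comp m_cvg delta_cvg.
pose zC n := G (a n) - P (G (a n)).
have zC_cvg : zC @ \oo --> 0.
  have GC : continuous G by move=> u; exact: differentiable_continuous.
  apply/norm_cvg0P.
  apply: (@squeeze_cvgr _ _ _ _ (cst 0) (fun n => `|G xbar - G (a n)|)).
  - near=> n; rewrite normr_ge0/= distrC.
    by have [_ ] := PG (G (a n)); apply.
  - exact: cvg_cst.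
  - apply/norm_cvg0P; rewrite -(subrr (G xbar)).
    apply: cvgB; first exact: cvg_cst.
    exact: cvg_comp a_cvg (GC xbar).
split; first by split.
exists (fun n => (a n, b n)), (fun n => (g n, 0)),
  (fun n => (zC n, a n - b n)),
  (fun n => (tau (m n) *: zC n, tau (m n) *: (a n - b n))); split.
- exact: cvg_eprod.
- by apply: cvg_eprod => //; exact: cvg_cst.
- by apply: cvg_eprod => //; rewrite -xybar; exact: cvgB.
move=> n; split; last first.
  have -> : ((G (a n), a n - b n) : eprod Y X) - (zC n, a n - b n) =
      ((P (G (a n)), 0) : eprod Y X).
    by congr (_, _); rewrite /= ?subrr// subKr.
  apply: normal_cone_setX.
    apply: normal_cone_scale; first exact: ltW.
    exact: proj_normal.
  by split => // _ ->; rewrite subrr inner0r.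
(* [(a n, b n)] is a projection of [(a n, a n)], hence the normal vector
   [(0, tau (a n - b n))]. *)
exists (tau (m n) *: (((a n, a n) : eprod X X) - (a n, b n))).
  by apply: proj_limiting_normal; [exact: ltW|exact: proj_setTX].
apply: inner_eqP => h.
have fst_diff := is_diff_linear efst ((a n, b n) : eprod X X).
have snd_diff := is_diff_linear esnd ((a n, b n) : eprod X X).
have fh : is_diff ((a n, b n) : eprod X X) (fun w : eprod X X => f w.1)
    (fun v => 'd f (a n) v.1).
  exact: is_diff_comp fst_diff (differentiableP (df (a n))).
have dH : is_diff ((a n, b n) : eprod X X)
    (fun w : eprod X X => (G w.1, w.1 - w.2) : eprod Y X)
    (fun v => ('d G (a n) v.1, v.1 - v.2)).
  apply: is_diff_eprod.
  exact: is_diff_comp fst_diff (differentiableP (dG (a n))).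
have gP := inner_gradient_penalty (tau (m n)) (b n) h.1 (df (a n)) (dG (a n))
  C_nonempty C_closed C_convex (PG (G (a n))).
rewrite !innerDl (gradient_is_diff h fh) (innerC (adjoint _ _)) inner_adjoint.
rewrite (@diff_val _ _ _ _ _ _ _ dH).
rewrite !inner_eprod/= gP subrr scaler0.
rewrite (innerC 0) inner0r (innerC 0) inner0r !(innerC _ (tau (m n) *: _)).
rewrite innerDr innerNr; ring.
Unshelve. all: by end_near. Qed.
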